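(* Let $v_i^1,v_i^2,v_i^3$ ($i\in[n]$) be XOS valuations on the item set $[m]$, and for each $i$ independently let $(s_i,s'_i,r_i)$ be a uniformly random permutation of $(v_i^1,v_i^2,v_i^3)$. Run the Two Samples Algorithm (defined in the context) with samples $\mathbf{s},\mathbf{s}'$ and actual valuations $\mathbf{r}$, producing prices $\mathbf{p}^{(i)}$, bundles $A'_i=d_i(s'_i,\mathbf{p}^{(i)})$ and $B_i=d_i(r_i,\mathbf{p}^{(i)})$, and the item contributions $\mathsf{ALG}_j$. Assume there are no ties in the additive supporting valuations: in every realization of $\mathbf{s}$, for every item $j$, the positive numbers among $a_j(v_i^k,d_i(v_i^k,\mathbf{p}^{(i)}))$, taken over all $i\in[n]$ and the two indices $k\in\{1,2,3\}$ not assigned to $s_i$, are pairwise distinct. Then for every item $j\in[m]$, $$\mathbb{E}[\mathsf{ALG}_j]\ \ge\ \frac14\,\mathbb{E}\Big[\max\Big(\max_{i:\,j\in B_i}a_j(r_i,B_i),\ \max_{i:\,j\in A'_i}a_j(s'_i,A'_i)\Big)\Big],$$ where a maximum over the empty set is $0$.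
   Context: Valuations are functions $v:2^{[m]}\to\mathbb{R}_{\ge0}$ with $v(\emptyset)=0$ that are monotone. $v$ is XOS if there is a finite collection of additive functions $a_\ell(B)=\sum_{j\in B}a_\ell(j)$ with $a_\ell(j)\ge0$ such that $v(B)=\max_\ell a_\ell(B)$ for all $B\subseteq[m]$. For an XOS valuation $v$ and $B\subseteq[m]$ fix an additive function from the collection attaining the maximum for $B$; $a_j(v,B)$ denotes its value on item $j$ if $j\in B$, and $0$ if $j\notin B$. Demand: for each buyer $i$, valuation $v$ and prices $\mathbf{p}\in\mathbb{R}_{\ge0}^m$, $d_i(v,\mathbf{p})$ denotes a set $B\subseteq[m]$ maximizing $v(B)-\sum_{j\in B}p_j$, with ties broken by a fixed deterministic rule. Two Samples Algorithm. (1) Prices (modified buyer-wise greedy on $\mathbf{s}$): let $\mathcal{P}=\{2^k:k\in\mathbb{Z}\}$, $p_j^{(1)}=0$ for all $j$; for $i=1,\dots,n$ let $A_i=d_i(s_i,\mathbf{p}^{(i)})$, set $p_j^{(i+1)}=\min\{p\in\mathcal{P}:p\ge a_j(s_i,A_i)\}$ for $j\in A_i$ (with $p_j^{(i+1)}=0$ if $a_j(s_i,A_i)=0$) and $p_j^{(i+1)}=p_j^{(i)}$ for $j\notin A_i$. (2) Base prices: with $A'_i=d_i(s'_i,\mathbf{p}^{(i)})$, let $b_j=\max_{i:\,j\in A'_i}a_j(s'_i,A'_i)$ ($0$ if there is no such $i$). (3) Buyers $i=1,\dots,n$ with valuations $r_i$ arrive in this order; let $B_i=d_i(r_i,\mathbf{p}^{(i)})$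 and allocate to buyer $i$ all still unallocated items in $B_i\cap\{j: a_j(r_i,B_i)>b_j\}$. $\mathsf{ALG}_j=a_j(r_i,B_i)$ if item $j$ is allocated to buyer $i$, and $\mathsf{ALG}_j=0$ if $j$ is not allocated. Expectations are over the random permutations. *)

(* Defs.v *)
From mathcomp Require Import all_boot all_order all_algebra all_fingroup.
From mathcomp Require Import boolp classical_sets reals.

Set Implicit Arguments.
Unset Strict Implicit.
Unset Printing Implicit Defensive.

Import Order.TTheory GRing.Theory Num.Theory.
Local Open Scope ring_scope.

(* Finite functions are used throughout so that equality of valuations and of
   price vectors is extensional: a choice depending on them is a function of
   the mathematical object. *)
Notation set_function R m := {ffun {set 'I_m} -> R}.
Notation item_vector R m := {ffun 'I_m -> R}.

Section Valuations.
Variables (R : realType) (m : nat).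
Implicit Types (v : set_function R m) (B : {set 'I_m}) (c : item_vector R m).

Definition additive_fun c B : R := \sum_(j in B) c j.

Definition is_valuation v : Prop :=
  [/\ v finset.set0 = 0, forall B, 0 <= v B
    & forall B C : {set 'I_m}, B \subset C -> v B <= v C].

(* The default value 0 of the iterated maximum is harmless: the collection is
   nonempty and its members are nonnegative. *)
Definition xos_collection v (cs : seq (item_vector R m)) : Prop :=
  [/\ cs != [::], forall c, c \in cs -> forall j, 0 <= c j
    & forall B, v B = \big[Num.max/0]_(c <- cs) additive_fun c B].

Definition is_xos v : Prop :=
  is_valuation v /\ exists cs, xos_collection v cs.

(* [a v B j] is the value a_j(v, B). *)
Definition supporting_choice
    (a : set_function R m -> {set 'I_m} -> 'I_m -> R) : Prop :=
  forall v, is_xos v -> exists2 cs, xos_collection v cs &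
    forall B, exists c, [/\ c \in cs, additive_fun c B = v B
      & forall j, a v B j = if j \in B then c j else 0].

Definition utility v (p : item_vector R m) B : R := v B - additive_fun p B.

Definition demand_rule n
    (d : 'I_n -> set_function R m -> item_vector R m -> {set 'I_m}) : Prop :=
  forall i v (p : item_vector R m), is_valuation v -> (forall j, 0 <= p j) ->
  forall B, utility v p B <= utility v p (d i v p).

End Valuations.

Section PriceGrid.
Variable R : realType.

Definition price_grid : set R := range (fun k : int => 2 ^ k).

(* For x > 0 the infimum is attained: see [round_up_min]. *)
Definition round_up (x : R) : R :=
  if x == 0 then 0 else inf [set p | price_grid p /\ x <= p]%classic.

Lemma round_up_min (x : R) : 0 < x ->
  [/\ price_grid (round_up x), x <= round_up x
    & forall p, price_grid p -> x <= p -> round_up x <= p].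
Proof.
move=> x0; rewrite /round_up gt_eqF//.
have pow_lt_bound (y : R) : 0 <= y -> y < 2 ^+ Num.bound y.
  move=> y0; apply: lt_trans (archi_boundP y0) _.
  by rewrite -natrX ltr_nat ltn_expl.
pose N := Num.bound x^-1.
have Nx : (2 : R) ^ (- N%:Z) < x.
  rewrite -invr_expz -exprnP -[ltRHS]invrK ltf_pV2 ?posrE ?invr_gt0//.
    by apply: pow_lt_bound; rewrite invr_ge0 ltW.
  by rewrite exprn_gt0.
have exP : exists k : nat, x <= (2 : R) ^ (k%:Z - N%:Z).
  exists (Num.bound x + N)%N; rewrite PoszD addrK -exprnP ltW//.
  by apply: pow_lt_bound; rewrite ltW.
case: (ex_minnP exP) => k xk kmin.
have lek p : price_grid p -> x <= p -> 2 ^ (k%:Z - N%:Z) <= p.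
  case=> z _ <- xz.
  have Nz : - N%:Z < z.
    by have := lt_le_trans Nx xz; rewrite ltr_eXz2l// ltr1n.
  have zN0 : 0 <= z + N%:Z by rewrite -lerBlDr sub0r ltW.
  rewrite ler_eXz2l ?ltr1n// lerBlDr.
  move: xz zN0; rewrite -{1}(addrK N%:Z z).
  by case: (z + N%:Z) => // q xq _; rewrite lez_nat; exact: kmin.
suff -> : inf [set p | price_grid p /\ x <= p]%classic = 2 ^ (k%:Z - N%:Z).
  by split => //; exists (k%:Z - N%:Z).
apply/eqP; rewrite eq_le; apply/andP; split.
  apply: ge_inf; first by exists x => p [].
  by split => //; exists (k%:Z - N%:Z).
apply: lb_le_inf; last by move=> p [] ? ?; exact: lek.
by exists (2 ^ (k%:Z - N%:Z)); split => //; exists (k%:Z - N%:Z).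
Qed.

End PriceGrid.

Section TwoSamples.
Variables (R : realType) (n m : nat).
Variable a : set_function R m -> {set 'I_m} -> 'I_m -> R.
Variable d : 'I_n -> set_function R m -> item_vector R m -> {set 'I_m}.
Variables s s' r : 'I_n -> set_function R m.

Definition price_update (p : item_vector R m) (i : 'I_n) : item_vector R m :=
  let A := d i (s i) p in
  [ffun j => if j \in A then round_up (a (s i) A j) else p j].

(* [prices i] is p^(i), obtained by processing the buyers preceding i;
   [enum 'I_n] lists the buyers in increasing order. *)
Definition prices (i : 'I_n) : item_vector R m :=
  foldl price_update [ffun => 0] [seq k : 'I_n <- enum 'I_n | (k < i)%N].

Definition sample_bundle (i : 'I_n) : {set 'I_m} := d i (s' i) (prices i).

Definition bundle (i : 'I_n) : {set 'I_m} := d i (r i) (prices i).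

Definition base_price (j : 'I_m) : R :=
  \big[Num.max/0]_(i | j \in sample_bundle i) a (s' i) (sample_bundle i) j.

Definition allocate (o : {ffun 'I_m -> option 'I_n}) (i : 'I_n) :
    {ffun 'I_m -> option 'I_n} :=
  [ffun j => if o j is Some k then Some k
             else if (j \in bundle i) && (base_price j < a (r i) (bundle i) j)
             then Some i else None].

Definition allocation : {ffun 'I_m -> option 'I_n} :=
  foldl allocate [ffun => None] (enum 'I_n).

Definition ALG (j : 'I_m) : R :=
  if allocation j is Some i then a (r i) (bundle i) j else 0.

End TwoSamples.

Section RandomAssignment.
Variables (R : realType) (n : nat).

(* Independent uniform permutations of the three indices, one per buyer, are
   the uniform distribution on ['S_3]-valued families. *)
Definition assignment := {ffun 'I_n -> 'S_3}.

Definition expectation (f : assignment -> R) : R :=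
  (\sum_(sigma : assignment) f sigma) / #|assignment|%:R.

(* Position 0 of the permuted triple is s_i, position 1 is s'_i and
   position 2 is r_i. *)
Definition drawn (T : Type) (v : 'I_n -> 'I_3 -> T) (sigma : assignment)
    (pos : 'I_3) (i : 'I_n) : T := v i (sigma i pos).

End RandomAssignment.

(* Main.v *)
(** Fix the samples [s], hence the prices. It remains to toss, for each buyer, a
    fair coin deciding which of its two other valuations is the actual one and
    which one sets base prices. Among the 2n supporting values of item [j], let
    x be the largest and y the second largest. Whatever the coins, the benchmark
    is at most x. With probability at least 1/4 (two coins, or only one if x and
    y belong to the same buyer), x is actual while y sets the base price; then
    x is the only actual value above the base price y, so ALG_j = x. *)

Require Import Defs.
From mathcomp Require Import all_boot all_order all_algebra all_fingroup.
From mathcomp Require Import reals.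

Set Implicit Arguments.
Unset Strict Implicit.
Unset Printing Implicit Defensive.

Import Order.TTheory GRing.Theory Num.Theory.
Local Open Scope ring_scope.

Section Coins.
Variables (R : realDomainType) (I : finType).
Implicit Types eps : {ffun I -> bool}.

Definition toss (k : I) (c : bool) eps : {ffun I -> bool} :=
  [ffun i => eps i (+) (c && (i == k))].

Lemma tossK k c : involutive (toss k c).
Proof. by move=> eps; apply/ffunP => i; rewrite !ffunE addbK. Qed.

(** For each fixed pair [c] the two tosses permute the coin outcomes, so each of the four pairs
    contributes the whole sum; [k = l] is allowed. *)
Lemma sum_toss2 (g : {ffun I -> bool} -> R) (k l : I) :
  \sum_eps \sum_(c : bool * bool) g (toss l c.2 (toss k c.1 eps)) =
  4 * \sum_eps g eps.
Proof.
rewrite exchange_big /= (eq_bigr (fun=> \sum_eps g eps)) => [|c _].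
  by rewrite sumr_const card_prod card_bool mulr_natl.
rewrite [RHS](reindex_inj (inv_inj (tossK l c.2))) /=.
by rewrite [RHS](reindex_inj (inv_inj (tossK k c.1))).
Qed.

(* [Y (i, eps i)] plays the role of the base-price sample of buyer [i] and
   [Y (i, ~~ eps i)] that of its actual value. *)
Lemma sum_max_le_4sum (Y : I * bool -> R) (g : {ffun I -> bool} -> R) :
  (forall p, 0 <= Y p) ->
  (forall p q, p != q -> 0 < Y p -> 0 < Y q -> Y p != Y q) ->
  (forall eps, 0 <= g eps) ->
  (forall eps, let b := \big[Num.max/0]_i Y (i, eps i) in
    (exists i, b < Y (i, ~~ eps i)) ->
    exists2 i, b < Y (i, ~~ eps i) & g eps = Y (i, ~~ eps i)) ->
  \sum_(eps : {ffun I -> bool}) Num.max (\big[Num.max/0]_i Y (i, ~~ eps i))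
                    (\big[Num.max/0]_i Y (i, eps i)) <= 4 * \sum_eps g eps.
Proof.
move=> Y0 Yinj g0 gP.
have le_max M : 0 <= M -> (forall p, Y p <= M) -> forall eps,
    Num.max (\big[Num.max/0]_i Y (i, ~~ eps i))
            (\big[Num.max/0]_i Y (i, eps i)) <= M.
  by move=> M0 YM eps; rewrite ge_max !bigmax_le.
have [/existsP[p0 p0P]|/existsPn Ynpos] := boolP [exists p, 0 < Y p]; last first.
  apply: (@le_trans _ _ 0).
    by apply: sumr_le0 => eps _; apply: le_max => // p; rewrite leNgt.
  by rewrite mulr_ge0 // sumr_ge0.
pose top := [arg max_(p > p0) Y p]%O.
have topP p : Y p <= Y top.
  by rewrite /top; case: Order.TotalTheory.arg_maxP => // q _; exact.
case Etop: top topP => [i1 c1] topP.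
have top_gt0 : 0 < Y (i1, c1) := lt_le_trans p0P (topP p0).
have sndN : (i1, ~~ c1) != (i1, c1) by rewrite xpair_eqE eqxx; case: (c1).
have [[i2 c2] sndNtop sndP] : exists2 q, q != (i1, c1) &
    forall p, p != (i1, c1) -> Y p <= Y q.
  exists [arg max_(p > (i1, ~~ c1) | p != (i1, c1)) Y p]%O;
    by case: Order.TotalTheory.arg_maxP.
(* Distinctness is only known for positive values; a nonpositive runner-up lies below the positive
   top anyway. *)
have snd_lt_top : Y (i2, c2) < Y (i1, c1).
  rewrite lt_neqAle topP andbT.
  have [snd0|] := ltP 0 (Y (i2, c2)); first exact: Yinj.
  by move=> snd0; rewrite lt_eqF // (le_lt_trans snd0).
have g_top eps : eps i1 = ~~ c1 -> eps i2 = c2 -> g eps = Y (i1, c1).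
  move=> eps1 eps2.
  have bE : \big[Num.max/0]_i Y (i, eps i) = Y (i2, c2).
    apply/eqP; rewrite eq_le -{2}eps2 le_bigmax andbT.
    apply: bigmax_le => // i _; apply: sndP; rewrite xpair_eqE.
    by apply/negP => /andP[/eqP-> /eqP]; rewrite eps1; case: (c1).
  (* The top value exceeds the base price, and no other value does, so the winner supplied by [gP]
     is the top. *)
  have [|i] := gP eps; rewrite bE; first by exists i1; rewrite eps1 negbK.
  move=> snd_lt ->; congr Y; apply/eqP; apply: contraTT snd_lt => /sndP.
  by rewrite leNgt.
(* It now suffices that, for every [eps], one of the four tossed outcomes reaches the top value. *)
rewrite -(sum_toss2 g i1 i2); apply: ler_sum => eps _.
apply: (le_trans (le_max _ (Y0 _) topP eps)).
(* These bits flip exactly the coins that are wrong. If [i2 = i1], then [c2 = ~~ c1], so the first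
   toss settles both requirements and the second must do nothing. *)
pose e1 := eps i1 (+) ~~ c1.
pose e2 := (i2 != i1) && (eps i2 (+) c2).
rewrite (bigD1 (e1, e2)) //= g_top ?lerDl ?sumr_ge0 //.
- rewrite !ffunE /e1 /e2 eqxx andbT [i1 == i2]eq_sym.
  by case: (i2 == i1); case: (eps i1); case: (c1); rewrite /= ?andbF.
- rewrite !ffunE /e1 /e2 eqxx andbT.
  have [ei|] := eqVneq i2 i1; last by case: (eps i2); case: (c2); rewrite andbF.
  move: sndNtop; rewrite ei xpair_eqE eqxx /=.
  by case: (eps i1); case: (c1); case: (c2).
Qed.

End Coins.

Section Allocation.
Variables (R : realType) (n m : nat).
Variable a : set_function R m -> {set 'I_m} -> 'I_m -> R.
Variable d : 'I_n -> set_function R m -> item_vector R m -> {set 'I_m}.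
Variables s s' r : 'I_n -> set_function R m.

Let winning j i := (j \in bundle a d s r i) &&
  (base_price a d s s' j < a (r i) (bundle a d s r i) j).

(** An allocated item never changes hands, so the fold keeps the earliest buyer passing the
    base-price test. *)
Lemma allocationE j :
  allocation a d s s' r j = ohead [seq i <- enum 'I_n | winning j i].
Proof.
suff allocE l o : foldl (allocate a d s s' r) o l j =
    if o j is Some k then Some k else ohead [seq i <- l | winning j i].
  by rewrite /allocation allocE ffunE.
elim: l o => [|i l IHl] o /=; first by case: (o j).
rewrite IHl ffunE; case: (o j) => //.
by rewrite -/(winning j i); case: (winning j i).
Qed.

Lemma ALG_winning j : (exists i, winning j i) ->
  exists2 i, winning j i & ALG a d s s' r j = a (r i) (bundle a d s r i) j.
Proof.
case=> i wi; rewrite /ALG allocationE.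
have : i \in [seq i <- enum 'I_n | winning j i] by rewrite mem_filter wi mem_enum.
case E: [seq i <- _ | _] => [//|k l] _ /=; exists k => //.
by have : k \in k :: l; [exact: mem_head|rewrite -E mem_filter => /andP[]].
Qed.

End Allocation.

Section Swap.
Variable n : nat.

(** As [(s * t) x = t (s x)], multiplying on the left exchanges the positions of [s'] and [r],
    whatever indices they hold. *)
Definition swap_draws (eps : {ffun 'I_n -> bool}) (sigma : assignment n) :
    assignment n :=
  [ffun i => if eps i then (tperm 1%R 2%R * sigma i)%g else sigma i].

Lemma swap_draws_inj eps : injective (swap_draws eps).
Proof.
move=> sigma tau /ffunP eq_st; apply/ffunP => i.
by have := eq_st i; rewrite !ffunE; case: (eps i) => // /mulgI.
Qed.

Lemma swap_draws0 eps sigma i : swap_draws eps sigma i 0 = sigma i 0.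
Proof. by rewrite ffunE; case: (eps i) => //; rewrite permM tpermD. Qed.

Lemma swap_draws1 eps sigma i :
  swap_draws eps sigma i 1 = sigma i (if eps i then 2 else 1 : 'I_3).
Proof. by rewrite ffunE; case: (eps i) => //; rewrite permM tpermL. Qed.

Lemma swap_draws2 eps sigma i :
  swap_draws eps sigma i 2 = sigma i (if ~~ eps i then 2 else 1 : 'I_3).
Proof. by rewrite ffunE; case: (eps i) => //; rewrite permM tpermR. Qed.

(** Each swap permutes the assignments, so summing over [eps] as well multiplies both totals by the
    same positive factor. This reduces the claim to coin tosses with the samples [s] fixed. *)
Lemma ler_expectation_swap (R : realType) (c : R) (f g : assignment n -> R) :
  (forall sigma, c * \sum_eps f (swap_draws eps sigma) <=
                 \sum_eps g (swap_draws eps sigma)) ->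
  c * expectation f <= expectation g.
Proof.
have sum_swap h : \sum_sigma \sum_eps h (swap_draws eps sigma) =
    #|{ffun 'I_n -> bool}|%:R * \sum_sigma h sigma :> R.
  rewrite exchange_big /= (eq_bigr (fun=> \sum_sigma h sigma)) => [|eps _].
    by rewrite sumr_const mulr_natl.
  by rewrite [RHS](reindex_inj (@swap_draws_inj eps)).
move=> le_fg; rewrite /expectation mulrA ler_wpM2r ?invr_ge0 ?ler0n //.
have card0 : 0 < #|{ffun 'I_n -> bool}|%:R :> R.
  by rewrite ltr0n card_ffun card_bool expn_gt0.
rewrite -(ler_pM2l card0) mulrCA -!sum_swap mulr_sumr.
by apply: ler_sum => sigma _; exact: le_fg.
Qed.

End Swap.

Theorem lemma3p6 (R : realType) (n m : nat)
    (a : set_function R m -> {set 'I_m} -> 'I_m -> R)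
    (d : 'I_n -> set_function R m -> item_vector R m -> {set 'I_m})
    (v : 'I_n -> 'I_3 -> set_function R m)
    (a_supporting : supporting_choice a)
    (d_demand : demand_rule d)
    (v_xos : forall (i : 'I_n) (k : 'I_3), is_xos (v i k))
    (no_ties : forall (sigma : assignment n) (j : 'I_m)
        (i1 i2 : 'I_n) (k1 k2 : 'I_3),
      let s := drawn v sigma 0 in
      let x (i : 'I_n) (k : 'I_3) :=
        a (v i k) (d i (v i k) (prices a d s i)) j in
      k1 != sigma i1 0 -> k2 != sigma i2 0 ->
      (i1, k1) != (i2, k2) -> 0 < x i1 k1 -> 0 < x i2 k2 ->
      x i1 k1 != x i2 k2)
    (j : 'I_m) :
  1 / 4 * expectation (fun sigma : assignment n =>
      let s := drawn v sigma 0 in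
      let s' := drawn v sigma 1 in
      let r := drawn v sigma 2 in
      let A' := sample_bundle a d s s' in
      let B := bundle a d s r in
      Num.max
        (\big[Num.max/0]_(i < n | j \in B i) a (r i) (B i) j)
        (\big[Num.max/0]_(i < n | j \in A' i) a (s' i) (A' i) j))
  <= expectation (fun sigma : assignment n =>
      ALG a d (drawn v sigma 0) (drawn v sigma 1) (drawn v sigma 2) j).
Proof.
have [a_ge0 a_notin] : (forall i k B j, 0 <= a (v i k) B j) /\
    (forall i k (B : {set 'I_m}) j, j \notin B -> a (v i k) B j = 0).
  split=> i k B j'; have [cs [_ cs0 _] /(_ B)[c [c_cs _ ->]]] :=
    a_supporting _ (v_xos i k); last by move=> /negPf->.
  by case: ifP => // _; exact: cs0 c_cs j'.
apply: ler_expectation_swap => sigma.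
rewrite mul1r mulrC ler_pdivrMr // mulrC.
pose s := drawn v sigma 0.
pose k (p : 'I_n * bool) := sigma p.1 (if p.2 then 2 else 1 : 'I_3).
pose Y p := a (v p.1 (k p)) (d p.1 (v p.1 (k p)) (prices a d s p.1)) j.
have drawn0 eps : drawn v (swap_draws eps sigma) 0 = s.
  by apply: boolp.funext => i; rewrite /drawn swap_draws0.
have k_neq0 p : k p != sigma p.1 0.
  by rewrite (inj_eq perm_inj); case: p.2.
(* Supporting values vanish off the bundle, so the maximum may run over all buyers. It serves base
   prices too, since [sample_bundle] unfolds to [bundle] at [s']. *)
have max_bundle t (c : 'I_n -> bool) :
    (forall i, t i = v i (k (i, c i))) ->
    \big[Num.max/0]_(i < n | j \in bundle a d s t i)
      a (t i) (bundle a d s t i) j = \big[Num.max/0]_i Y (i, c i).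
  move=> tE; rewrite bigmax_mkcond; apply: eq_bigr => i _.
  rewrite /bundle tE /Y /=.
  by case: ifPn => // /a_notin->.
have sampleE eps : forall i,
    drawn v (swap_draws eps sigma) 1 i = v i (k (i, eps i)).
  by move=> i; rewrite /drawn swap_draws1.
have actualE eps : forall i,
    drawn v (swap_draws eps sigma) 2 i = v i (k (i, ~~ eps i)).
  by move=> i; rewrite /drawn swap_draws2.
have bundleE eps i : a (drawn v (swap_draws eps sigma) 2 i)
    (bundle a d s (drawn v (swap_draws eps sigma) 2) i) j = Y (i, ~~ eps i).
  by rewrite /bundle actualE.
rewrite (eq_bigr (fun eps : {ffun 'I_n -> bool} =>
    Num.max (\big[Num.max/0]_i Y (i, ~~ eps i))
            (\big[Num.max/0]_i Y (i, eps i)))) => [|eps _]; last first.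
  rewrite /= drawn0 (max_bundle _ (fun i => ~~ eps i) (actualE eps)).
  by rewrite -(max_bundle _ (fun i => eps i) (sampleE eps)).
under [X in _ <= _ * X]eq_bigr => eps _ do rewrite drawn0.
apply: sum_max_le_4sum => [p|p q pq|eps|eps b].
- exact: a_ge0.
- apply: (no_ties sigma j p.1 q.1 (k p) (k q)); rewrite ?k_neq0 //.
  case: p q pq => [i c] [i' c']; rewrite !xpair_eqE /k /=.
  by have [->|//] := eqVneq i i'; rewrite (inj_eq perm_inj); case: c c' => -[].
- by rewrite /ALG; case: (allocation _ _ _ _ _ j) => // i; exact: a_ge0.
have winE i : (j \in bundle a d s (drawn v (swap_draws eps sigma) 2) i) &&
    (base_price a d s (drawn v (swap_draws eps sigma) 1) j <
     a (drawn v (swap_draws eps sigma) 2 i)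
       (bundle a d s (drawn v (swap_draws eps sigma) 2) i) j) =
    (b < Y (i, ~~ eps i)).
  rewrite /base_price (max_bundle _ (fun i => eps i) (sampleE eps)) -/b bundleE.
  (* Off the bundle the value is 0, which cannot exceed a base price that is at least 0. *)
  rewrite andb_idl //; apply: contraTT => /a_notin.
  rewrite -bundleE => ->.
  by rewrite -leNgt; apply: bigmax_ge_id.
case=> i bi; have [|i' wi' ->] := @ALG_winning R n m a d s
    (drawn v (swap_draws eps sigma) 1) (drawn v (swap_draws eps sigma) 2) j.
  by exists i; rewrite winE.
by exists i'; rewrite ?bundleE // -winE.
Qed.
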